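(* Let $r\geq 2$ be an integer and fix a graph $F$ with $E(F)\neq\emptyset$. Then, as $n\to\infty$, \[{\rm ex}_{r}(n, {\rm B}_{\rm ind} F) = \Theta\Big(\max_{2 \leq s \leq r}\{{\rm ex}(n,K_{s}, F) \}\Big).\]
   Context: An $r$-uniform hypergraph ($r$-graph) $\mathcal H$ is a family of $r$-element subsets (its edges) of a finite vertex set $V(\mathcal H)$. For a graph $F$ with vertex set $\{v_1,\dots,v_p\}$ and edge set $\{e_1,\dots,e_q\}$, a hypergraph $\mathcal H$ contains an induced Berge $F$ if there exist distinct vertices $W=\{w_1,\dots,w_p\}\subseteq V(\mathcal H)$ and distinct edges $f_1,\dots,f_q$ of $\mathcal H$ such that whenever $e_i=v_\alpha v_\beta$ we have $f_i\cap W=\{w_\alpha,w_\beta\}$. ${\rm ex}_r(n,{\rm B}_{\rm ind}F)$ denotes the maximum number of edges of an $r$-uniform hypergraph on vertex set $[n]=\{1,\dots,n\}$ that contains no induced Berge $F$. For $s\ge 2$, ${\rm ex}(n,K_s,F)$ denotes the maximum number of $s$-element vertex sets spanning a complete graph $K_s$ in an $F$-free graph on $n$ vertices (an $F$-free graph is one with no subgraph isomorphic to $F$); in particular ${\rm ex}(n,K_2,F)={\rm ex}(n,F)$ is the usual Turán number. The asymptotics are as $n\to\infty$ with $r$ and $F$ fixed. *)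

(* Defs.v *)
From mathcomp Require Import all_boot.
From mathcomp Require Import boolp.

Set Implicit Arguments.
Unset Strict Implicit.
Unset Printing Implicit Defensive.

(* Hypergraphs on the vertex type [T] are given by their edge sets; a graph is
   a 2-uniform hypergraph. *)
Definition uniform (r : nat) (T : finType) (H : {set {set T}}) : Prop :=
  {in H, forall e : {set T}, #|e| = r}.

(* The distinct hyperedges f_1, ..., f_q are encoded by a map [f] that is
   injective on the edge set of [F]. *)
Definition induced_berge (V T : finType) (F : {set {set V}})
    (H : {set {set T}}) : Prop :=
  exists (w : V -> T) (f : {set V} -> {set T}),
    [/\ injective w,
        {in F &, injective f},
        {in F, forall e : {set V}, f e \in H} &
        forall a b : V, [set a; b] \in F ->
          f [set a; b] :&: [set w v | v : V] = [set w a; w b]].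

Definition contains_graph (V T : finType) (F : {set {set V}})
    (G : {set {set T}}) : Prop :=
  exists w : V -> T, injective w /\
    forall a b : V, [set a; b] \in F -> [set w a; w b] \in G.

Definition clique (T : finType) (G : {set {set T}}) (S : {set T}) : bool :=
  [forall x in S, forall y in S, (x != y) ==> ([set x; y] \in G)].

Definition ex_induced_berge (r n : nat) (V : finType) (F : {set {set V}}) :
    nat :=
  \max_(H : {set {set 'I_n}} | `[< uniform r H /\ ~ induced_berge F H >]) #|H|.

Definition ex_clique (n s : nat) (V : finType) (F : {set {set V}}) : nat :=
  \max_(G : {set {set 'I_n}} | `[< uniform 2 G /\ ~ contains_graph F G >])
    #|[set S : {set 'I_n} | (#|S| == s) && clique G S]|.

(* Main.v *)
(** Lower bound: for an F-free graph G, take s + 1 disjoint (r - s)-sets U_i.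
    Every s-clique of G misses some U_i, and the r-sets S :|: U_i, for S an
    s-clique missing U_i, contain no induced Berge F unless all edges of F share
    a vertex. In that case G has bounded degree, so O(n) cliques, while disjoint
    r-sets contain no induced Berge F as soon as F has two edges.

    Upper bound: by induction on s, a family of s-sets that are traces on some X
    of edges of an induced Berge F-free hypergraph H has size O(max). Remove the
    sets having an (s - 1)-subset of codegree at most #|V|. What is left is
    thick, so every pair in it can be extended to a member avoiding any given
    #|V| - 2 vertices: the graph of these pairs is F-free and the members are
    s-cliques of it. The number of removed sets is at most #|V| times the size
    of the (s - 1)-shadow, and averaging over U shows that a positive proportion
    of the shadow consists of traces of edges of H on X :&: U. *)

Require Import Defs.
From mathcomp Require Import all_boot all_order all_algebra.
From mathcomp Require Import boolp reals topology normedtype sequences landau.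
Import GRing.Theory Num.Theory numFieldNormedType.Exports.

Set Implicit Arguments.
Unset Strict Implicit.
Unset Printing Implicit Defensive.

(** * Induced Berge copies from traces *)

(* Used to move the isolated vertices of F away from the chosen hyperedges. *)
Lemma extend_injection (V T : finType) (D : {set V}) (B : {set T}) (w : V -> T) :
  {in D &, injective w} -> w @: D \subset B -> #|V| + #|B| <= #|T| ->
  exists w' : V -> T, [/\ injective w', {in D, w' =1 w} &
    forall v, v \notin D -> w' v \notin B].
Proof.
move=> winj wB leVT.
have lev (v : V) : enum_rank v < size (enum (~: B)).
  apply: leq_trans (ltn_ord _) _.
  by rewrite -cardE -(leq_add2r #|B|) addnC [X in _ <= X]addnC cardsC addnC.
(* Outside [D], distinct vertices go to distinct elements of the complement of [B]; by [lev] the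
   default of [nth] is never reached. *)
pose w' v := if v \in D then w v else nth (w v) (enum (~: B)) (enum_rank v).
have w'D : {in D, w' =1 w} by move=> v vD; rewrite /w' vD.
have w'B v : v \notin D -> w' v \notin B.
  move=> vD; rewrite -in_setC -mem_enum /w' (negPf vD).
  by rewrite mem_nth.
exists w'; split=> // u v.
have wDB x : x \in D -> w' x \in B.
  by move=> xD; rewrite w'D // (subsetP wB) ?imset_f.
case: (boolP (u \in D)) (boolP (v \in D)) => [uD|uD] [vD|vD] E.
- by apply: winj; rewrite -?w'D.
- by move: (w'B _ vD); rewrite -E wDB.
- by move: (w'B _ uD); rewrite E wDB.
move: E; rewrite /w' (negPf uD) (negPf vD) (set_nth_default (w u) (w v)) //.
move/eqP; rewrite nth_uniq ?enum_uniq // => /eqP/val_inj.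
exact: enum_rank_inj.
Qed.

Lemma leq_card_bigcup (I T : finType) (P : pred I) (A : I -> {set T}) :
  #|\bigcup_(i | P i) A i| <= \sum_(i | P i) #|A i|.
Proof.
apply: (big_ind2 (fun (B : {set T}) n => #|B| <= n)); rewrite ?cards0 //.
by move=> B m C n Bm Cn; apply: leq_trans (leq_card_setU _ _) (leq_add Bm Cn).
Qed.

(* The hyperedges for distinct e are automatically distinct, since their traces
   w @: e are. *)
Lemma traces_induced_berge (V T : finType) (F : {set {set V}})
    (H : {set {set T}}) (r : nat) (X : {set T}) (w : V -> T) :
  uniform 2 F -> uniform r H -> #|V| + (#|V| + #|F| * r) <= #|T| ->
  injective w ->
  (forall e, e \in F ->
    exists2 h, h \in H & h :&: X :&: w @: [set: V] = w @: e) ->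
  induced_berge F H.
Proof.
move=> F2 Hr leT winj tr.
have /choice[f fP] e : exists h, e \in F ->
    h \in H /\ h :&: X :&: w @: [set: V] = w @: e.
  case: (boolP (e \in F)) => [/tr[h hH hE]|_]; first by exists h.
  by exists set0.
(* [B] holds the images of the non-isolated vertices and all chosen hyperedges. *)
pose B := w @: cover F :|: \bigcup_(e in F) f e.
have leB : #|B| <= #|V| + #|F| * r.
  apply: leq_trans (leq_card_setU _ _) _; rewrite leq_add //.
    exact: leq_trans (leq_imset_card _ _) (max_card _).
  apply: leq_trans (leq_card_bigcup _ _) _.
  by rewrite -sum_nat_const; apply: leq_sum => e /fP[/Hr->].
have [|||w' [w'inj w'D w'B]] := @extend_injection _ _ (cover F) B w.
- by move=> u v _ _; apply: winj.
- exact: subsetUl.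
- by apply: leq_trans leT; rewrite leq_add2l.
(* Traces are known only inside [X], but [v] lies in some edge [e'], whose trace puts [w v] in [X];
   hence the trace of [f e] decides whether [v] is in [e]. *)
have fwP e v : e \in F -> w v \in f e -> v \in cover F -> v \in e.
  move=> eF wf /bigcupP[e' e'F ve'].
  have [_ fe] := fP _ eF; have [_ fe'] := fP _ e'F.
  rewrite -(mem_imset e v winj) -fe !inE wf imset_f // andbT.
  have: w v \in w @: e' by rewrite imset_f.
  by rewrite -fe' !inE => /andP[/andP[]].
exists w', f; split=> // [e e' eF e'F fee'|e /fP[]//|a b abF].
  apply: (imset_inj winj).
  by have [_ <-] := fP _ eF; have [_ <-] := fP _ e'F; rewrite fee'.
have abD v : v \in [set a; b] -> v \in cover F.
  by move=> vab; apply/bigcupP; exists [set a; b].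
have [_ fab] := fP _ abF.
have wf v : v \in [set a; b] -> w' v \in f [set a; b].
  move=> vab; rewrite w'D ?abD //.
  have: w v \in w @: [set a; b] by rewrite imset_f.
  by rewrite -fab !inE => /andP[/andP[]].
apply/setP=> x; rewrite inE; apply/andP/idP => [[xf /imsetP[v _ xE]]|].
  have vD : v \in cover F.
    apply: contraT => /w'B; rewrite -xE inE negb_or => /andP[_].
    by move/bigcupP=> []; exists [set a; b].
  have: v \in [set a; b] by apply: fwP => //; rewrite -w'D // -xE.
  by rewrite xE !inE => /orP[]/eqP->; rewrite eqxx ?orbT.
by rewrite !inE => /orP[]/eqP->; rewrite wf ?imset_f // !inE eqxx ?orbT.
Qed.

(** * Shadows, thick families and dense traces *)

Definition shadow (T : finType) (TT : {set {set T}}) : {set {set T}} :=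
  [set B : {set T} | [exists A : {set T} in TT, (B \subset A) && (#|B|.+1 == #|A|)]].

(** For uniform [TT]: the minimum positive codegree exceeds [q]. *)
Definition thick (q : nat) (T : finType) (TT : {set {set T}}) : Prop :=
  forall A B : {set T}, A \in TT -> B \subset A -> #|B|.+1 = #|A| ->
    q < #|[set A' : {set T} in TT | B \subset A']|.

Lemma shadowP (T : finType) (TT : {set {set T}}) (B : {set T}) :
  reflect (exists2 A : {set T}, A \in TT & B \subset A /\ #|B|.+1 = #|A|)
          (B \in shadow TT).
Proof.
rewrite inE; apply: (iffP exists_inP) => [[A AT /andP[BA /eqP cA]]|[A AT [BA cA]]];
  by exists A; rewrite ?BA ?cA ?eqxx.
Qed.

(** Greedy deletion: while some shadow set [B] lies in at most [q] members, delete those members.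
    Then [B] leaves the shadow for good, so each shadow set pays for at most [q] deletions. *)
Lemma thick_subfamily (q : nat) (T : finType) (TT : {set {set T}}) :
  exists TT' : {set {set T}}, [/\ TT' \subset TT, thick q TT' &
    #|TT| <= #|TT'| + q * #|shadow TT|].
Proof.
have [n] := ubnP #|TT|; elim: n TT => // n IHn TT ltn.
have [thickT|] := pselect (thick q TT); first by exists TT; rewrite leq_addr.
move=> /existsNP[A] /existsNP[B] /not_implyP[AT] /not_implyP[BA] /not_implyP[cA].
move=> /negP; rewrite -leqNgt.
set E := [set _ in _ | _] => leE.
have ET : E \subset TT by apply/subsetP => A'; rewrite inE => /andP[].
have cT : #|TT| = #|TT :\: E| + #|E|.
  by rewrite -(cardsID E TT) (setIidPr ET) addnC.
have AE : A \in E by rewrite inE AT.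
have [|TT' [sTT' thT' leT]] := IHn (TT :\: E).
  rewrite -ltnS; apply: leq_trans ltn; rewrite ltnS cT -addn1 leq_add2l.
  by rewrite card_gt0; apply/set0Pn; exists A.
exists TT'; split=> //; first exact: subset_trans sTT' (subsetDl _ _).
have ltS : #|shadow (TT :\: E)| < #|shadow TT|.
  rewrite (cardsD1 B (shadow TT)).
  have -> : B \in shadow TT by apply/shadowP; exists A.
  rewrite ltnS subset_leq_card //; apply/subsetP => B' /shadowP[A'].
  rewrite inE => /andP[A'E A'T] [B'A' cA']; rewrite !inE; apply/andP; split.
    by apply: contraNneq A'E => EB; rewrite inE A'T -EB.
  by apply/exists_inP; exists A' => //; rewrite B'A' cA' eqxx.
rewrite cT; apply: leq_trans (leq_add leT leE) _.
by rewrite -addnA leq_add2l addnC -mulnS leq_mul2l ltS orbT.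
Qed.

(* Thickness lets one move the vertices of [A] lying in [W] but not in [P] out
   of [W], one at a time. *)
Lemma thick_avoid (s : nat) (T : finType) (TT : {set {set T}}) (A P W : {set T}) :
  uniform s TT -> thick #|W| TT -> A \in TT -> P \subset A ->
  exists2 A' : {set T}, A' \in TT & P \subset A' /\ A' :&: W \subset P.
Proof.
move=> sT thT; have [n] := ubnP #|(A :&: W) :\: P|.
elim: n A => // n IHn A ltn AT PA.
have [AWP|/subsetPn[a /setIP[aA aW] aP]] := boolP (A :&: W \subset P).
  by exists A.
have cAa : #|A :\ a|.+1 = #|A| by rewrite (cardsD1 a A) aA.
have [A' [A'T BA' A'W]] : exists A' : {set T},
    [/\ A' \in TT, A :\ a \subset A' & A' :&: W \subset A :\ a].
  (* Otherwise every member containing [A :\ a] adds to it a vertex of [W], leaving at most [#|W|]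
     such members, against thickness. *)
  apply: contrapT => noA'.
  have := thT A (A :\ a) AT (subsetDl _ _) cAa; apply/negP; rewrite -leqNgt.
  apply: leq_trans (leq_imset_card (fun x => x |: A :\ a) W).
  apply: subset_leq_card; apply/subsetP => A'; rewrite inE => /andP[A'T BA'].
  have /subsetPn[x /setIP[xA' xW] xB] : ~~ (A' :&: W \subset A :\ a).
    by apply/negP => A'W; apply: noA'; exists A'.
  apply/imsetP; exists x => //; apply/eqP; rewrite eq_sym eqEcard.
  rewrite subUset sub1set xA' BA' /= (sT _ A'T) -(sT _ AT) -cAa.
  by rewrite cardsU1 xB.
have PA' : P \subset A'.
  by apply: subset_trans BA'; rewrite subsetD1 PA.
apply: (IHn A') => //; rewrite -ltnS; apply: leq_trans ltn; rewrite ltnS.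
apply: proper_card; apply/properP; split.
  apply: setSD; rewrite subsetI subsetIr andbT.
  exact: subset_trans A'W (subsetDl _ _).
exists a; rewrite !inE ?aA ?aW ?aP //=.
apply: contraTN aP => /andP[aA' _].
by have := subsetP A'W a; rewrite !inE aA' aW eqxx; move/(_ isT).
Qed.

(** For a uniformly random [U], the trace of [A i] on [U] is [B i] with probability at least
    [2 ^ -s]; some [U] does at least as well as the average. *)
Lemma exists_dense_trace (I T : finType) (D : {set I}) (A B : I -> {set T}) (s : nat) :
  {in D, forall i, B i \subset A i /\ #|A i| = s} ->
  exists U : {set T}, #|D| <= 2 ^ s * #|[set i in D | A i :&: U == B i]|.
Proof.
move=> DAB; pose N U := #|[set i in D | A i :&: U == B i]|.
have [U _ maxU] := @arg_maxnP _ (set0 : {set T}) predT N isT.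
exists U; rewrite -/(N U) -(leq_pmul2r (expn_gt0 2 #|T|)).
have fiber i : i \in D -> 2 ^ #|T| <= 2 ^ s * #|[set U : {set T} | A i :&: U == B i]|.
  move=> /DAB[BA cA]; rewrite -cA -!card_powerset -[#|T|]cardsT -card_powerset.
  rewrite -cardsX.
  (* [g] stores the part of [Z] inside [A i] and replaces it by [B i]. Both parts of [Z] can be
     recovered, and the second component is always a good [U]. *)
  pose g (Z : {set T}) := (A i :&: Z, (Z :\: A i) :|: B i).
  have ginj : injective g.
    move=> Z Z' [E1 E2]; apply/setP => x.
    move/setP/(_ x): E1; move/setP/(_ x): E2; rewrite !inE.
    by case: (boolP (x \in A i)) => //= xA; rewrite (contraNF (subsetP BA x)) // !orbF.
  rewrite -(card_imset _ ginj) subset_leq_card //.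
  apply/subsetP => p /imsetP[Z _ ->]; rewrite !inE /= subsetIl /=.
  apply/eqP/setP => x; rewrite !inE.
  case: (boolP (x \in A i)) => //= xA.
  by rewrite (contraNF (subsetP BA x)).
(* Double counting of the pairs of an index and a good [U]. *)
have dc : \sum_(i in D) #|[set U : {set T} | A i :&: U == B i]| = \sum_U N U.
  under eq_bigr do rewrite -sum1dep_card.
  rewrite (exchange_big_dep predT) //=.
  by apply: eq_bigr => Z _; rewrite /N -sum1dep_card.
rewrite -sum_nat_const; apply: leq_trans (leq_sum _ fiber) _.
rewrite -big_distrr /= dc -mulnA leq_mul2l /=; apply/orP; right.
have -> : 2 ^ #|T| = #|{set T}| by rewrite -cardsT -card_powerset powersetT cardsT.
rewrite mulnC -sum_nat_const.
by apply: leq_sum => Z _; apply: maxU.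
Qed.

(** * Upper bound through families of traces *)

Lemma uniform2_exists (V : finType) (F : {set {set V}}) (e : {set V}) :
  uniform 2 F -> e \in F -> exists a b : V, a != b /\ e = [set a; b].
Proof. by move=> F2 /F2/eqP/cards2P[a [b [ab ->]]]; exists a, b. Qed.

Lemma leq_ex_clique (n s : nat) (V : finType) (F : {set {set V}})
    (G : {set {set 'I_n}}) :
  uniform 2 G -> ~ contains_graph F G ->
  #|[set S : {set 'I_n} | (#|S| == s) && clique G S]| <= ex_clique n s F.
Proof.
move=> G2 nFG.
rewrite /ex_clique (bigD1 G) /= ?leq_maxl //.
by apply/asboolP.
Qed.

Lemma leq_ex_induced_berge (r n : nat) (V : finType) (F : {set {set V}})
    (H : {set {set 'I_n}}) :
  uniform r H -> ~ induced_berge F H -> #|H| <= ex_induced_berge r n F.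
Proof.
move=> Hr nFH.
rewrite /ex_induced_berge (bigD1 H) /= ?leq_maxl //.
by apply/asboolP.
Qed.

(** The members of [TT] are cliques of the graph [G] of pairs they cover. If [G] had a copy of [F]
    on [W], each of its edges would extend to a trace meeting [W] in that edge only, giving an
    induced Berge [F]. *)
Lemma avoiding_traces_bound (V : finType) (F : {set {set V}}) (n r s : nat)
    (H TT : {set {set 'I_n}}) (X : {set 'I_n}) :
  uniform 2 F -> uniform r H -> ~ induced_berge F H ->
  #|V| + (#|V| + #|F| * r) <= n -> uniform s TT ->
  {in TT, forall A, exists2 h, h \in H & h :&: X = A} ->
  (forall A P W : {set 'I_n}, A \in TT -> P \subset A -> #|P| = 2 ->
    #|W| = #|V| ->
    exists2 A', A' \in TT & P \subset A' /\ A' :&: W \subset P) ->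
  #|TT| <= ex_clique n s F.
Proof.
move=> F2 Hr nFH len Ts trT avoid.
pose G := [set P : {set 'I_n} | (#|P| == 2) && [exists A in TT, P \subset A]].
have G2 : uniform 2 G by move=> P; rewrite inE => /andP[/eqP].
apply: leq_trans (leq_ex_clique s G2 _).
  apply: subset_leq_card; apply/subsetP => A AT; rewrite inE Ts // eqxx /=.
  apply/forall_inP => x xA; apply/forall_inP => y yA; apply/implyP => xy.
  rewrite inE cards2 xy /=; apply/exists_inP; exists A => //.
  by rewrite subUset !sub1set xA.
move=> [w [winj wG]]; apply: nFH.
apply: (@traces_induced_berge _ _ _ _ r X w) => //; first by rewrite card_ord.
move=> e eF; have [a [b [_ eE]]] := uniform2_exists F2 eF.
have : [set w a; w b] \in G by apply: wG; rewrite -eE.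
rewrite inE => /andP[/eqP cab /exists_inP[A AT abA]].
have [|A' A'T [abA' A'W]] := avoid A _ (w @: [set: V]) AT abA cab.
  by rewrite card_imset // cardsT.
have [h hH hX] := trT _ A'T; exists h => //.
rewrite hX eE imsetU1 imset_set1; apply/eqP; rewrite eqEsubset A'W.
by rewrite subsetI abA' subUset !sub1set !imset_f.
Qed.

(** Letting [X] vary keeps the hypothesis stable under induction: the sets selected from the shadow
    are traces on [X :&: U]. The constant is uniform in [n], [H] and [X]. *)
Lemma traces_bound (V : finType) (F : {set {set V}}) (r s : nat) :
  uniform 2 F -> 2 <= s <= r ->
  exists C, forall n (H TT : {set {set 'I_n}}) (X : {set 'I_n}),
    #|V| + (#|V| + #|F| * r) <= n ->
    uniform r H -> ~ induced_berge F H -> uniform s TT ->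
    {in TT, forall A, exists2 h, h \in H & h :&: X = A} ->
    #|TT| <= C * \max_(2 <= t < r.+1) ex_clique n t F.
Proof.
move=> F2; have leM n t : 2 <= t <= r ->
    ex_clique n t F <= \max_(2 <= t < r.+1) ex_clique n t F.
  by move=> tr; apply: (@leq_bigmax_seq _ _ xpredT (fun t => ex_clique n t F));
    rewrite ?mem_index_iota.
case: s => [//|[//|s]]; elim: s => [|s IHs] sr.
  (* For [s = 2] a member equals the pair it contains, so avoidance is automatic. *)
  exists 1 => n H TT X len Hr nFH Ts trT.
  rewrite mul1n; apply: leq_trans (leM _ 2 sr).
  apply: (avoiding_traces_bound F2 Hr nFH len Ts trT) => A P W AT PA cP _.
  exists A => //; split=> //.
  suff -> : P = A by apply: subsetIl.
  by apply/eqP; rewrite eqEcard PA cP Ts.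
have [|C Cbound] := IHs; first exact: ltnW.
(* The 1 pays for the thick part, [#|V|] for the deletions per shadow set, [2 ^ s.+3] for the
   averaging. *)
exists (1 + #|V| * (2 ^ s.+3 * C)) => n H TT X len Hr nFH Ts trT.
have [TT' [sTT' thT' leT]] := thick_subfamily #|V| TT.
rewrite mulnDl mul1n -(mulnA #|V|) -(mulnA _ C); apply: leq_trans leT (leq_add _ _).
  apply: leq_trans (leM _ _ sr).
  have Ts' : uniform s.+3 TT' by move=> A /(subsetP sTT')/Ts.
  apply: (avoiding_traces_bound (X := X) F2 Hr nFH len Ts').
    by move=> A /(subsetP sTT')/trT.
  by move=> A P W AT PA _ cW; apply: thick_avoid Ts' _ AT PA; rewrite cW.
rewrite leq_mul2l; apply/orP; right.
have /choice[A AP] B : exists A : {set 'I_n}, B \in shadow TT ->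
    A \in TT /\ B \subset A.
  case: (boolP (B \in shadow TT)) => [/shadowP[A AT [BA _]]|_]; last by exists set0.
  by exists A.
have [|U leU] := @exists_dense_trace _ _ (shadow TT) A id s.+3.
  by move=> B /AP[AT BA]; rewrite Ts.
apply: leq_trans leU _; rewrite leq_mul2l; apply/orP; right.
apply: (Cbound n H _ (X :&: U)) => // [B|B]; rewrite inE => /andP[BT /eqP AB].
  by have /shadowP[A' /Ts cA' [_]] := BT; rewrite cA' => -[].
have [/trT[h hH hX] _] := AP _ BT.
by exists h => //; rewrite setIA hX.
Qed.

Lemma ex_induced_berge_upper (V : finType) (F : {set {set V}}) (r : nat) :
  uniform 2 F -> 2 <= r ->
  exists C, forall n, #|V| + (#|V| + #|F| * r) <= n ->
    ex_induced_berge r n F <= C * \max_(2 <= s < r.+1) ex_clique n s F.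
Proof.
move=> F2 r2; have [|C Cbound] := @traces_bound V F r r F2; first by rewrite r2 /=.
exists C => n len; apply/bigmax_leqP => H /asboolP[Hr nFH].
(* Edges are their own traces on the whole vertex set. *)
by apply: (Cbound n H H setT) => // A AH; exists A; rewrite ?setIT.
Qed.

(** * Lower bound constructions *)

Lemma disjoint_sets (T : finType) (k m : nat) (A : {set T}) :
  k * m <= #|A| ->
  exists g : nat -> {set T},
    (forall i, i < k -> #|g i| = m /\ g i \subset A) /\
    forall i j, i < j < k -> [disjoint g i & g j].
Proof.
elim: k A => [|k IHk] A leA.
  by exists (fun=> set0); split=> [//|i j]; rewrite ltn0 andbF.
have [B BA cB] : exists2 B : {set T}, B \subset A & #|B| = m.
  exists [set x in take m (enum A)].
    by apply/subsetP => x; rewrite inE => /mem_take; rewrite mem_enum.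
  rewrite cardsE (card_uniqP _) ?take_uniq ?enum_uniq // size_takel // -cardE.
  by apply: leq_trans leA; rewrite mulSn leq_addr.
have [|g [gA gD]] := IHk (A :\: B).
  by rewrite cardsD (setIidPr BA) cB leq_subRL ?(leq_trans _ leA) // leq_addr.
exists (fun i => if i == k then B else g i); split=> [i|i j].
  rewrite ltnS leq_eqVlt; case: eqVneq => [_ _|_ /gA[-> giA]]; first by [].
  by split=> //; apply: subset_trans giA (subsetDl _ _).
rewrite ltnS [j <= k]leq_eqVlt => /andP[ij]; case: (eqVneq j k) => /= [jk _|_ jk].
  have ik : i < k by rewrite -jk.
  rewrite (ltn_eqF ik) disjoint_sym disjoints_subset subsetC.
  have [_ giA] := gA _ ik; apply: subset_trans giA _.
  by rewrite setDE subsetIr.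
by rewrite (ltn_eqF (ltn_trans ij jk)) gD // ij.
Qed.

Lemma ex_clique_nonstar (V : finType) (F : {set {set V}}) (n r s : nat) :
  uniform 2 F -> (forall v, exists2 e, e \in F & v \notin e) -> s <= r ->
  s.+1 * (r - s) <= n ->
  ex_clique n s F <= s.+1 * ex_induced_berge r n F.
Proof.
move=> F2 nostar sr len; apply/bigmax_leqP => G /asboolP[G2 nFG].
set K := [set S | _].
have [|g [gc gD]] := @disjoint_sets _ s.+1 (r - s) [set: 'I_n].
  by rewrite cardsT card_ord.
pose K' (i : 'I_s.+1) := [set S in K | [disjoint S & g i]].
have KK' : K \subset \bigcup_i K' i.
  apply/subsetP => S SK; apply: contraT => /bigcupP noi.
  (* Meeting all [s.+1] disjoint sets would give the [s]-set [S] too many vertices. *)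
  have /choice[x xP] (i : 'I_s.+1) : exists x, x \in S /\ x \in g i.
    have /pred0Pn[x /andP[xS xg]] : ~~ [disjoint S & g i].
      by apply/negP => Si; apply: noi; exists i => //; rewrite inE SK.
    by exists x.
  have xinj : injective x.
    have ng (i j : 'I_s.+1) : x i = x j -> i < j -> False.
      move=> xij ltij; have ijs : i < j < s.+1 by rewrite ltij ltn_ord.
      by have := disjointFr (gD _ _ ijs) (proj2 (xP i)); rewrite xij (proj2 (xP j)).
    move=> i j xij; have [ij|ij|/val_inj//] := ltngtP i j.
      by case: (ng i j).
    by case: (ng j i).
  have : #|x @: [set: 'I_s.+1]| <= #|S|.
    by apply/subset_leq_card/subsetP => y /imsetP[i _ ->]; have [] := xP i.
  rewrite card_imset // cardsT card_ord.
  by move: SK; rewrite inE => /andP[/eqP-> _]; rewrite ltnn.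
apply: leq_trans (subset_leq_card KK') _.
apply: leq_trans (leq_card_bigcup _ _) _.
rewrite -[X in _ <= X * _]card_ord -sum_nat_const; apply: leq_sum => i _.
have gi : #|g i| = r - s by have [] := gc i (ltn_ord i).
pose H := [set S :|: g i | S in K' i].
have Sg : {in K' i &, injective (fun S => S :|: g i)}.
  move=> S S'; rewrite !inE => /andP[_ Sd] /andP[_ S'd] /(congr1 (fun A => A :\: g i)).
  by rewrite !setDUl setDv !setU0 !(setDidPl _).
rewrite -(card_in_imset Sg); apply: leq_ex_induced_berge.
  move=> h /imsetP[S]; rewrite !inE => /andP[/andP[/eqP cS _] Sd] ->.
  rewrite cardsU cS gi (eqP (_ : S :&: g i == set0)) ?setI_eq0 //.
  by rewrite cards0 subn0 subnKC.
move=> [w [f [winj _ fH fP]]]; apply: nFG.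
(* All hyperedges contain [g i], so a vertex [w v] in it would lie in the hyperedge of an edge [e]
   missing [v]. Hence the copy lives in the cliques [S], and [G] contains [F]. *)
have wg v : w v \notin g i.
  apply/negP => wvg; have [e eF ve] := nostar v.
  have [a [b [_ eE]]] := uniform2_exists F2 eF.
  have /imsetP[S _ fS] := fH _ eF.
  have : w v \in [set w a; w b].
    by rewrite -fP -eE // fS !inE wvg orbT imset_f.
  by move: ve; rewrite eE !inE !(inj_eq winj) => /negPf->.
exists w; split=> // a b abF.
have ab : a != b by move: (F2 _ abF); rewrite cards2; case: eqP.
have /imsetP[S] := fH _ abF; rewrite !inE => /andP[/andP[_ clS] _] fS.
have wS v : v \in [set a; b] -> w v \in S.
  move=> vab; have : w v \in f [set a; b] :&: [set w v | v : V].
    by rewrite fP //; move: vab; rewrite !inE !(inj_eq winj).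
  by rewrite fS !inE (negPf (wg v)) orbF => /andP[].
move/forall_inP: clS => /(_ (w a) (wS _ _)); rewrite !inE eqxx => /(_ isT).
move/forall_inP => /(_ (w b) (wS _ _)); rewrite !inE eqxx orbT => /(_ isT).
by rewrite (inj_eq winj) ab.
Qed.

(** A vertex [x] with more than [#|V|] neighbours would be the centre of a copy of the star [F]. So
    degrees are at most [#|V|], and each clique is some [x] with a subset of its neighbourhood. *)
Lemma ex_clique_star (V : finType) (F : {set {set V}}) (n s : nat) (v : V) :
  uniform 2 F -> {in F, forall e : {set V}, v \in e} -> 0 < s ->
  ex_clique n s F <= n * 2 ^ #|V|.
Proof.
move=> F2 vF s0; apply/bigmax_leqP => G /asboolP[G2 nFG].
pose N x := [set y | [set x; y] \in G].
have degG x : #|N x| <= #|V|.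
  rewrite leqNgt; apply/negP => ltV; apply: nFG.
  pose w u := if u == v then x else nth x (enum (N x)) (enum_rank u).
  have lt_rank (u : V) : enum_rank u < size (enum (N x)).
    by rewrite -cardE; apply: ltn_trans (ltn_ord _) ltV.
  have wN u : u != v -> w u \in N x.
    by move=> uv; rewrite /w (negPf uv) -mem_enum mem_nth.
  have xN : x \notin N x.
    by rewrite inE; apply/negP => /G2; rewrite cards2 eqxx.
  exists w; split=> [u u'|a b abF].
    have [->|uv] := eqVneq u v; have [->|u'v] := eqVneq u' v => //.
    - by move=> E; have := wN _ u'v; rewrite -E /w eqxx (negPf xN).
    - by move=> E; have := wN _ uv; rewrite E /w eqxx (negPf xN).
    rewrite /w (negPf uv) (negPf u'v) => /eqP.
    by rewrite nth_uniq ?enum_uniq // => /eqP/val_inj/enum_rank_inj.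
  have ab : a != b by move: (F2 _ abF); rewrite cards2; case: eqP.
  have := vF _ abF; rewrite !inE => /orP[]/eqP vE; move: ab.
    by rewrite -vE eq_sym => /wN; rewrite inE /w eqxx.
  by rewrite -vE => /wN; rewrite inE [w v]/w eqxx setUC.
apply: (@leq_trans #|\bigcup_x [set x |: S | S in powerset (N x)]|).
  apply/subset_leq_card/subsetP => S; rewrite inE => /andP[/eqP cS clS].
  have /set0Pn[x xS] : S != set0 by rewrite -card_gt0 cS.
  apply/bigcupP; exists x => //; apply/imsetP; exists (S :\ x); rewrite ?setD1K //.
  rewrite inE; apply/subsetP => y; rewrite !inE => /andP[yx yS].
  move/forall_inP: clS => /(_ _ xS)/forall_inP/(_ _ yS).
  by rewrite eq_sym yx.
apply: leq_trans (leq_card_bigcup _ _) _.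
rewrite -[X in _ <= X * _]card_ord -sum_nat_const; apply: leq_sum => x _.
apply: leq_trans (leq_imset_card _ _) _.
by rewrite card_powerset leq_pexp2l.
Qed.

(** Any edge of [G] would give a copy of [F], as there is room for the isolated vertices. *)
Lemma ex_clique_single (V : finType) (F : {set {set V}}) (n s : nat) :
  uniform 2 F -> #|F| = 1 -> #|V| + #|V| <= n -> 1 < s -> ex_clique n s F = 0.
Proof.
move=> F2 /eqP/cards1P[e FE] len s1.
apply/eqP; rewrite -leqn0; apply/bigmax_leqP => G /asboolP[G2 nFG].
rewrite leqn0 cards_eq0; apply/eqP/setP => S; rewrite !inE.
apply/negP => /andP[/eqP cS clS]; apply: nFG.
have : 1 < #|S| by rewrite cS.
case/card_gt1P => x [y [xS yS xy]].
have xyG : [set x; y] \in G.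
  by move/forall_inP: clS => /(_ _ xS)/forall_inP/(_ _ yS); rewrite xy.
have eF : e \in F by rewrite FE inE.
have [a [b [ab eE]]] := uniform2_exists F2 eF.
pose w0 u := if u == a then x else y.
have [|||w [winj wD _]] := @extend_injection _ _ e (w0 @: e) w0.
- move=> u u'; rewrite eE !inE /w0 => /orP[]/eqP-> /orP[]/eqP->;
    by rewrite ?eqxx // eq_sym (negPf ab) => E; move: xy; rewrite E eqxx.
- by [].
- rewrite card_ord; apply: leq_trans len; rewrite leq_add2l.
  exact: leq_trans (leq_imset_card _ _) (max_card _).
exists w; split=> // c d; rewrite FE inE => /eqP cd.
have -> : [set w c; w d] = w @: e by rewrite -cd imsetU1 imset_set1.
by rewrite eE imsetU1 imset_set1 !wD ?eE ?inE ?eqxx ?orbT // /w0 eqxx eq_sym (negPf ab).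
Qed.

(** Take [n %/ r] disjoint hyperedges. In an induced Berge [F] all hyperedges contain [w v], hence
    coincide, although [F] has two edges. *)
Lemma leq_ex_induced_berge_linear (V : finType) (F : {set {set V}}) (n r : nat)
    (v : V) :
  {in F, forall e : {set V}, v \in e} -> uniform 2 F -> 1 < #|F| -> 0 < r <= n ->
  n <= 2 * r * ex_induced_berge r n F.
Proof.
move=> vF F2 F1 /andP[r0 rn].
(* Since [n %/ r] is positive, rounding down loses at most a factor 2. *)
have nlt : n <= 2 * r * (n %/ r).
  apply: ltnW; apply: leq_trans (ltn_ceil n r0) _.
  by rewrite mulnAC leq_mul2r mul2n -addnn -add1n leq_add2r divn_gt0 ?rn ?orbT.
apply: leq_trans nlt _; rewrite leq_mul2l; apply/orP; right.
have [|g [gc gD]] := @disjoint_sets _ (n %/ r) r [set: 'I_n].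
  by rewrite cardsT card_ord leq_divM.
have gx (i j : 'I_(n %/ r)) x : x \in g i -> x \in g j -> i = j.
  move=> xi xj; have [ij|ij|/val_inj//] := ltngtP i j.
    have /gD/disjointFr/(_ xi) : i < j < n %/ r by rewrite ij /=.
    by rewrite xj.
  have /gD/disjointFr/(_ xj) : j < i < n %/ r by rewrite ij /=.
  by rewrite xi.
have ginj : injective (fun i : 'I_(n %/ r) => g i).
  move=> i j gij; have /set0Pn[x xi] : g i != set0.
    by rewrite -card_gt0 (proj1 (gc i (ltn_ord i))).
  by apply: (gx _ _ x); rewrite // -gij.
rewrite -[n %/ r]card_ord -cardsT -(card_imset _ ginj).
apply: leq_ex_induced_berge => [h /imsetP[i _ ->]|[w [f [_ finj fH fP]]]].
  by have [] := gc i (ltn_ord i).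
have wvf e : e \in F -> w v \in f e.
  move=> eF; have [a [b [_ eE]]] := uniform2_exists F2 eF.
  have : w v \in f e :&: [set w u | u : V].
    rewrite eE fP -?eE //; have := vF _ eF.
    by rewrite eE !inE => /orP[]/eqP->; rewrite eqxx ?orbT.
  by rewrite inE => /andP[].
case/card_gt1P: F1 => e [e' [eF e'F]]; apply/negP/negPn/eqP; apply: finj => //.
have [/imsetP[i _ fi] /imsetP[j _ fj]] := (fH _ eF, fH _ e'F).
by have := wvf _ eF; have := wvf _ e'F; rewrite fi fj => wj wi; rewrite (gx _ _ _ wi wj).
Qed.

Lemma ex_induced_berge_lower (V : finType) (F : {set {set V}}) (r : nat) :
  uniform 2 F -> F != set0 -> 2 <= r ->
  exists C n0, forall n, n0 <= n ->
    \max_(2 <= s < r.+1) ex_clique n s F <= C * ex_induced_berge r n F.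
Proof.
move=> F2 F0 r2.
suff [C [n0 H]] : exists C n0, forall n s, n0 <= n -> 2 <= s <= r ->
    ex_clique n s F <= C * ex_induced_berge r n F.
  exists C, n0 => n len; rewrite big_nat_cond; apply/bigmax_leqP_seq => s _.
  by rewrite andbT; apply: H.
have [[v vF]|nostar] := pselect (exists v, {in F, forall e : {set V}, v \in e}).
  have [F1|F1] := leqP #|F| 1.
    (* With a single edge the clique counts vanish, so the constant 0 suffices. *)
    exists 0, (#|V| + #|V|) => n s len /andP[s2 _].
    rewrite ex_clique_single //; apply/eqP; rewrite eqn_leq F1.
    by rewrite card_gt0.
  exists (2 ^ #|V| * (2 * r)), r => n s len /andP[s2 _].
  apply: leq_trans (ex_clique_star n F2 vF (ltnW s2)) _.
  rewrite mulnC -mulnA leq_mul2l; apply/orP; right.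
  by apply: leq_ex_induced_berge_linear vF F2 F1 _; rewrite len andbT ltnW.
exists r.+1, (r.+1 * r) => n s len /andP[s2 sr].
apply: leq_trans (@ex_clique_nonstar V F n r s F2 _ sr _) _.
- move=> v; apply: contrapT => nov; apply: nostar; exists v => e eF.
  by apply: contraT => ve; case: nov; exists e.
- by apply: leq_trans len; apply: leq_mul => //; rewrite leq_subr.
- by rewrite leq_mul2r ltnS sr orbT.
Qed.

(** * Passage to asymptotic notation *)

Local Open Scope classical_set_scope.
Local Open Scope ring_scope.

Lemma bigO_nat (R : realType) (f g : nat -> nat) (C n0 : nat) :
  (forall n, n0 <= n -> f n <= C * g n)%N ->
  (fun n => (f n)%:R : R^o) =O_\oo (fun n => (g n)%:R : R^o).
Proof.
(* The constant must be positive here, while [C] may be 0. *)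
move=> fg; apply/eqO_exP; exists C.+1%:R; first by rewrite ltr0n.
exists n0 => // n /= len; rewrite !normr_nat -natrM ler_nat.
by apply: leq_trans (fg n len) _; rewrite leq_mul2r leqnSn orbT.
Qed.

Theorem theorem2p1 (R : realType) (r : nat) (V : finType) (F : {set {set V}}) :
  (2 <= r)%N -> uniform 2 F -> F != set0 ->
  (fun n : nat => (ex_induced_berge r n F)%:R : R^o)
    =Theta_\oo
  (fun n : nat => (\max_(2 <= s < r.+1) ex_clique n s F)%N%:R : R^o).
Proof.
move=> r2 F2 F0; have [C upper] := ex_induced_berge_upper F2 r2.
have [C' [n0 lower]] := ex_induced_berge_lower F2 F0 r2.
rewrite eqThetaE bigThetaE eqOmegaO; split.
  exact: bigO_nat upper.
exact: bigO_nat lower.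
Qed.
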